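(* Assume the standing assumptions below, let $X_*$ be the unique symmetric positive semidefinite solution of $\mathscr R(X)=0$, and suppose there exists $\alpha>0$ with $\mathscr F_{X_*}(Z)\succeq\alpha Z$ for all symmetric $Z\succeq0$. Consider the modified Newton iteration: given symmetric $X_0$, for $k\ge0$ let $X_{k+1}$ solve $$\widehat A_k^{\mathsf T}X_{k+1}+X_{k+1}\widehat A_k+\widehat\Pi_k(X_k)+M_k=0,$$ with $R_k=R+\Pi_{22}(X_k)$, $S_k=X_kB+L+\Pi_{12}(X_k)$, $\widehat A_k=A-BR_k^{-1}S_k^{\mathsf T}$, $P_k=\begin{bmatrix}I_n\\-R_k^{-1}S_k^{\mathsf T}\end{bmatrix}$, $\widehat\Pi_k(X)=P_k^{\mathsf T}\Pi(X)P_k$, $M_k=P_k^{\mathsf T}\begin{bmatrix}Q&L\\L^{\mathsf T}&R\end{bmatrix}P_k$. Suppose $0\preceq X_0\preceq X_*$, $\mathscr R(X_0)\succeq0$, and $F_W(Y)-(Y-W)BR^{-1}B^{\mathsf T}(Y-W)\succeq0$ for all symmetric $W,Y$ with $X_0\preceq W\preceq Y\preceq X_*$. If the sequence $\{X_k\}$ exists and $X_k\succeq0$ for all $k$, then (a) $0\preceq X_0\preceq X_1\preceq\cdots\preceq X_k\preceq X_*$ and $\mathscr R(X_k)\succeq0$ for all $k\ge0$; (b) $\lim_{k\to\infty}X_k=X_*$.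
   Context: Data: $A,Q\in\mathbb{R}^{n\times n}$, $B,L\in\mathbb{R}^{n\times m}$, $R\in\mathbb{R}^{m\times m}$, $A_0^i\in\mathbb{R}^{n\times n}$, $B_0^i\in\mathbb{R}^{n\times m}$ ($i=1,\dots,r$); $A_0^0=A$, $B_0^0=B$. For symmetric $X$: $\Pi(X)=\begin{bmatrix}\Pi_{11}(X)&\Pi_{12}(X)\\\Pi_{12}(X)^{\mathsf T}&\Pi_{22}(X)\end{bmatrix}$ with $\Pi_{11}(X)=\sum_{i=1}^r (A_0^i)^{\mathsf T}XA_0^i$, $\Pi_{12}(X)=\sum_i (A_0^i)^{\mathsf T}XB_0^i$, $\Pi_{22}(X)=\sum_i (B_0^i)^{\mathsf T}XB_0^i$; $L_{\mathrm c}=L+\Pi_{12}$, $R_{\mathrm c}=R+\Pi_{22}$, $Q_{\mathrm c}=Q+\Pi_{11}$; $A_{\mathrm c}(X)=A-BR_{\mathrm c}(X)^{-1}L_{\mathrm c}(X)^{\mathsf T}$, $G_{\mathrm c}(X)=BR_{\mathrm c}(X)^{-1}B^{\mathsf T}$, $H_{\mathrm c}(X)=Q_{\mathrm c}(X)-L_{\mathrm c}(X)R_{\mathrm c}(X)^{-1}L_{\mathrm c}(X)^{\mathsf T}$; $\Omega(X)=\begin{bmatrix}-G_{\mathrm c}(X)&-A_{\mathrm c}(X)\\-A_{\mathrm c}(X)^{\mathsf T}&H_{\mathrm c}(X)\end{bmatrix}$; $\mathscr R(X)=\begin{bmatrix}X\\-I\end{bmatrix}^{\mathsf T}\Omega(X)\begin{bmatrix}X\\-I\end{bmatrix}$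 (equivalently $A^{\mathsf T}X+XA+Q+\Pi_{11}(X)-[XB+L+\Pi_{12}(X)][R+\Pi_{22}(X)]^{-1}[XB+L+\Pi_{12}(X)]^{\mathsf T}$). For symmetric $W$: $\mathscr F_W(Z)=\begin{bmatrix}-I_n\\R_{\mathrm c}(W)^{-1}[L_{\mathrm c}(W)+WB]^{\mathsf T}\end{bmatrix}^{\mathsf T}\Pi(Z)\begin{bmatrix}-I_n\\R_{\mathrm c}(W)^{-1}[L_{\mathrm c}(W)+WB]^{\mathsf T}\end{bmatrix}$ and $F_W(Y)=\begin{bmatrix}Y\\-I_n\end{bmatrix}^{\mathsf T}[\Omega(Y)-\Omega(W)]\begin{bmatrix}Y\\-I_n\end{bmatrix}$. Standing assumptions: (1) $R\succ0$, $\begin{bmatrix}Q&L\\L^{\mathsf T}&R\end{bmatrix}\succeq0$; (2) there is $F\in\mathbb{R}^{m\times n}$ with $\dot S=(A+BF)S+S(A+BF)^{\mathsf T}+\sum_{i=1}^r(A_0^i+B_0^iF)S(A_0^i+B_0^iF)^{\mathsf T}$ exponentially stable; (3) with $C^{\mathsf T}C=Q-LR^{-1}L^{\mathsf T}$, $C\in\mathbb{R}^{p\times n}$, and $\widetilde A_0^i=A_0^i-B_0^iR^{-1}L^{\mathsf T}$, there is $K\in\mathbb{R}^{n\times p}$ with $\dot S=(\widetilde A_0^0+KC)S+S(\widetilde A_0^0+KC)^{\mathsf T}+\sum_{i=1}^r\widetilde A_0^iS(\widetilde A_0^i)^{\mathsf T}$ exponentially stable; (4) $\mathcal N(Q-LR^{-1}L^{\mathsf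 T})\subseteq\mathcal N(L^{\mathsf T})\cap\bigcap_i\mathcal N(A_0^i)$; (5) $(A,B)$ stabilizable and $(Q-LR^{-1}L^{\mathsf T},A)$ detectable. Under (1)–(3), $\mathscr R(X)=0$ has a unique positive semidefinite solution $X_*$. *)

(* Defs.v *)
From HB Require Import structures.
From mathcomp Require Import all_boot all_order all_algebra.
From mathcomp Require Import all_classical all_reals all_analysis.
Set Implicit Arguments. Unset Strict Implicit. Unset Printing Implicit Defensive.
Import Order.TTheory GRing.Theory Num.Theory.
Import numFieldNormedType.Exports.
Local Open Scope ring_scope.

Section Defs.
Variable R : realType.

Definition psd (k : nat) (X : 'M[R]_k) : Prop :=
  X^T = X /\ forall v : 'cV[R]_k, 0 <= (v^T *m X *m v) 0 0.

Definition pd (k : nat) (X : 'M[R]_k) : Prop :=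
  X^T = X /\ forall v : 'cV[R]_k, v != 0 -> 0 < (v^T *m X *m v) 0 0.

Definition loewner_le (k : nat) (X Y : 'M[R]_k) : Prop := psd (Y - X).

Definition symm (k : nat) (X : 'M[R]_k) : Prop := X^T = X.

(** a norm on matrices (all norms are equivalent in finite dimension) *)
Definition mxnorm (a b : nat) (M : 'M[R]_(a, b)) : R :=
  \sum_(i < a) \sum_(j < b) `|M i j|.

Definition ode_solution (a b : nat) (T : 'M[R]_(a, b) -> 'M[R]_(a, b))
    (S : R -> 'M[R]_(a, b)) : Prop :=
  forall (t : R) (i : 'I_a) (j : 'I_b),
    derivable (fun s => S s i j) t 1 /\
    derive1 (fun s => S s i j) t = T (S t) i j.

Definition exp_stable (a b : nat) (T : 'M[R]_(a, b) -> 'M[R]_(a, b)) : Prop :=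
  exists c beta : R, 0 < c /\ 0 < beta /\
    forall S : R -> 'M[R]_(a, b), ode_solution T S ->
      forall t : R, 0 <= t -> mxnorm (S t) <= c * expR (- (beta * t)) * mxnorm (S 0).

Definition hurwitz (k : nat) (A : 'M[R]_k) : Prop :=
  exp_stable (fun x : 'cV[R]_k => A *m x).

Definition stabilizable (n m : nat) (A : 'M[R]_n) (B : 'M[R]_(n, m)) : Prop :=
  exists F : 'M[R]_(m, n), hurwitz (A + B *m F).

Definition detectable (p n : nat) (C : 'M[R]_(p, n)) (A : 'M[R]_n) : Prop :=
  exists K : 'M[R]_(n, p), hurwitz (A + K *m C).

Variables (n m r : nat).
Variables (A : 'M[R]_n) (B : 'M[R]_(n, m)) (Q : 'M[R]_n) (L : 'M[R]_(n, m))
          (Rm : 'M[R]_m) (A0 : 'I_r -> 'M[R]_n) (B0 : 'I_r -> 'M[R]_(n, m)).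

Definition Pi11 (X : 'M[R]_n) : 'M[R]_n := \sum_(i < r) (A0 i)^T *m X *m A0 i.
Definition Pi12 (X : 'M[R]_n) : 'M[R]_(n, m) := \sum_(i < r) (A0 i)^T *m X *m B0 i.
Definition Pi22 (X : 'M[R]_n) : 'M[R]_m := \sum_(i < r) (B0 i)^T *m X *m B0 i.
Definition Pi (X : 'M[R]_n) : 'M[R]_(n + m) :=
  block_mx (Pi11 X) (Pi12 X) (Pi12 X)^T (Pi22 X).

Definition Lc X := L + Pi12 X.
Definition Rc X := Rm + Pi22 X.
Definition Qc X := Q + Pi11 X.
Definition Ac X : 'M[R]_n := A - B *m invmx (Rc X) *m (Lc X)^T.
Definition Gc X : 'M[R]_n := B *m invmx (Rc X) *m B^T.
Definition Hc X : 'M[R]_n := Qc X - Lc X *m invmx (Rc X) *m (Lc X)^T.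
Definition Omega X : 'M[R]_(n + n) :=
  block_mx (- Gc X) (- Ac X) (- (Ac X)^T) (Hc X).

Definition XI (Y : 'M[R]_n) : 'M[R]_(n + n, n) := col_mx Y (- 1%:M).

Definition Ricc (X : 'M[R]_n) : 'M[R]_n := (XI X)^T *m Omega X *m XI X.

Definition FcalW (W Z : 'M[R]_n) : 'M[R]_n :=
  let V : 'M[R]_(n + m, n) :=
    col_mx (- 1%:M) (invmx (Rc W) *m (Lc W + W *m B)^T) in
  V^T *m Pi Z *m V.

Definition FW (W Y : 'M[R]_n) : 'M[R]_n :=
  (XI Y)^T *m (Omega Y - Omega W) *m XI Y.

Definition Rk (Xk : 'M[R]_n) : 'M[R]_m := Rm + Pi22 Xk.
Definition Sk (Xk : 'M[R]_n) : 'M[R]_(n, m) := Xk *m B + L + Pi12 Xk.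
Definition Ahat (Xk : 'M[R]_n) : 'M[R]_n := A - B *m invmx (Rk Xk) *m (Sk Xk)^T.
Definition Pk (Xk : 'M[R]_n) : 'M[R]_(n + m, n) :=
  col_mx 1%:M (- (invmx (Rk Xk) *m (Sk Xk)^T)).
Definition Pihat (Xk X : 'M[R]_n) : 'M[R]_n := (Pk Xk)^T *m Pi X *m Pk Xk.
Definition Mk (Xk : 'M[R]_n) : 'M[R]_n :=
  (Pk Xk)^T *m block_mx Q L L^T Rm *m Pk Xk.

Definition newton_step (Xk Xk1 : 'M[R]_n) : Prop :=
  (Ahat Xk)^T *m Xk1 + Xk1 *m Ahat Xk + Pihat Xk Xk + Mk Xk = 0.

End Defs.

(* Main.v *)
Require Import Defs.
From HB Require Import structures.
From mathcomp Require Import all_boot all_order all_algebra.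
From mathcomp Require Import all_classical all_reals all_analysis.
From mathcomp Require Import complex ring lra.
Import Order.TTheory GRing.Theory Num.Theory.
Import numFieldNormedType.Exports.
Local Open Scope ring_scope.
Local Open Scope classical_set_scope.

(** Write [E = V - W]. The left-hand side of the Newton equation at [W] is the linearization
    [Ricc W + Ahat^T E + E Ahat] of the Riccati map with [Pi] frozen at [W], while
    [Ricc V] equals this linearization minus [E Gc(W) E] plus [F_W V]. As
    [Gc W <= B R^-1 B^T], the hypothesis on [F_W] puts [Ricc V] above the linearization.
    Hence [V - W] and [Xs - V] satisfy Lyapunov inequalities for [Ahat], which give
    [W <= V <= Xs] as soon as [Ahat] is stable, and then [0 <= Ricc V]. Stability of [Ahat]
    comes from the Newton equation itself: its solution is positive semidefinite, and an
    unstable eigenvector of [Ahat] is annihilated by [Q - L R^-1 L^T], hence by the feedback,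
    so that it would be an undetectable mode of [A]. The monotone limit solves
    [Ricc X = 0] and is [Xs] by uniqueness. *)

Set Implicit Arguments.
Unset Strict Implicit.
Unset Printing Implicit Defensive.

(** * Entrywise rules and tactics for matrix polynomial identities *)

Section MatrixEntries.

Lemma addmxE {V : nmodType} a b (M N : 'M[V]_(a, b)) i j :
  (M + N) i j = M i j + N i j.
Proof. by rewrite mxE. Qed.

Lemma oppmxE {V : zmodType} a b (M : 'M[V]_(a, b)) i j : (- M) i j = - M i j.
Proof. by rewrite mxE. Qed.

Lemma scalemxE {V : pzRingType} a b c (M : 'M[V]_(a, b)) i j :
  (c *: M) i j = c * M i j.
Proof. by rewrite mxE. Qed.

Lemma trmxD {V : nmodType} a b (M N : 'M[V]_(a, b)) : (M + N)^T = M^T + N^T.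
Proof. by apply/matrixP=> i j; rewrite !mxE. Qed.

Lemma trmxN {V : zmodType} a b (M : 'M[V]_(a, b)) : (- M)^T = - M^T.
Proof. by apply/matrixP=> i j; rewrite !mxE. Qed.

Lemma trmxZ {V : pzRingType} a b c (M : 'M[V]_(a, b)) : (c *: M)^T = c *: M^T.
Proof. by apply/matrixP=> i j; rewrite !mxE. Qed.

End MatrixEntries.

(* Expanding to a signed sum of left-nested monomials and evaluating at an entry
   turns an identity of noncommutative matrix polynomials into one for [ring]. *)
Ltac mx_expand :=
  rewrite ?(trmxD, trmxN, trmxZ, trmx_mul, trmxK, mulmxDl, mulmxDr, mulmxN, mulNmx,
    mulmxA, opprD, opprK, trmx1, mul1mx, mulmx1, =^~ scalemxAl, =^~ scalemxAr, scalerDr, scalerN).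
Ltac mx_ring :=
  apply/matrixP=> ? ?; rewrite ?(addmxE, oppmxE, scalemxE); ring.

(** * Semidefinite matrices and the Loewner order *)

Section SemidefiniteMatrices.
Context {R : realType}.

Definition bform {a b : nat} (M : 'M[R]_(a, b)) (u : 'cV[R]_a) (v : 'cV[R]_b) : R :=
  (u^T *m M *m v) 0 0.

Lemma bform_mxD a b (M N : 'M[R]_(a, b)) u v :
  bform (M + N) u v = bform M u v + bform N u v.
Proof. by rewrite /bform mulmxDr mulmxDl addmxE. Qed.

Lemma bform_mxN a b (M : 'M[R]_(a, b)) u v : bform (- M) u v = - bform M u v.
Proof. by rewrite /bform mulmxN mulNmx oppmxE. Qed.

Lemma bformC k (M : 'M[R]_k) u v : M^T = M -> bform M u v = bform M v u.
Proof.
move=> sM; rewrite /bform -[in LHS](trmxK (u^T *m M *m v)) mxE !trmx_mul trmxK sM.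
by rewrite mulmxA.
Qed.

Lemma bform_mulr a b c (M : 'M[R]_(a, b)) (N : 'M[R]_(b, c)) u v :
  bform (M *m N) u v = bform M u (N *m v).
Proof. by rewrite /bform !mulmxA. Qed.

Lemma bform_mull a b c (M : 'M[R]_(a, b)) (N : 'M[R]_(c, a)) u v :
  bform (N *m M) u v = bform M (N^T *m u) v.
Proof. by rewrite /bform trmx_mul trmxK !mulmxA. Qed.

Lemma bformDr a b (M : 'M[R]_(a, b)) u v w :
  bform M u (v + w) = bform M u v + bform M u w.
Proof. by rewrite /bform mulmxDr addmxE. Qed.

Lemma bformZr a b (M : 'M[R]_(a, b)) u v c : bform M u (c *: v) = c * bform M u v.
Proof. by rewrite /bform -scalemxAr scalemxE. Qed.

Lemma bformDl a b (M : 'M[R]_(a, b)) u v w :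
  bform M (u + v) w = bform M u w + bform M v w.
Proof. by rewrite /bform trmxD !mulmxDl addmxE. Qed.

Lemma bformZl a b (M : 'M[R]_(a, b)) u v c : bform M (c *: u) v = c * bform M u v.
Proof. by rewrite /bform trmxZ -!scalemxAl scalemxE. Qed.

Lemma bform_delta a b (M : 'M[R]_(a, b)) i j :
  bform M (delta_mx i 0) (delta_mx j 0) = M i j.
Proof. by rewrite /bform trmx_delta -mulmxA -colE -rowE !mxE. Qed.

Lemma psd0 k : psd (0 : 'M[R]_k).
Proof. by split=> [|v]; rewrite ?trmx0 // mulmx0 mul0mx mxE. Qed.

Lemma psdD k (M N : 'M[R]_k) : psd M -> psd N -> psd (M + N).
Proof.
move=> [sM pM] [sN pN]; split=> [|v]; first by rewrite trmxD sM sN.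
by rewrite mulmxDr mulmxDl addmxE addr_ge0.
Qed.

Lemma psd_sum k (I : finType) (F : I -> 'M[R]_k) :
  (forall i, psd (F i)) -> psd (\sum_i F i).
Proof. by move=> pF; elim/big_rec: _ => [|i x _]; [exact: psd0 | exact: psdD]. Qed.

Lemma psdZ k (c : R) (M : 'M[R]_k) : 0 <= c -> psd M -> psd (c *: M).
Proof.
move=> c0 [sM pM]; split=> [|v]; first by rewrite trmxZ sM.
by rewrite -scalemxAr -scalemxAl scalemxE mulr_ge0.
Qed.

Lemma psd_congr k l (M : 'M[R]_k) (V : 'M[R]_(k, l)) :
  psd M -> psd (V^T *m M *m V).
Proof.
move=> [sM pM]; split=> [|v]; first by rewrite !trmx_mul trmxK sM mulmxA.
by have := pM (V *m v); rewrite trmx_mul !mulmxA.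
Qed.

Lemma loewner_trans k (X Y Z : 'M[R]_k) :
  loewner_le X Y -> loewner_le Y Z -> loewner_le X Z.
Proof.
rewrite /loewner_le => XY YZ; have := psdD YZ XY.
by rewrite addrA subrK.
Qed.

Lemma loewner_refl k (X : 'M[R]_k) : loewner_le X X.
Proof. by rewrite /loewner_le subrr; exact: psd0. Qed.

(** When [v] is isotropic, the form at [u + t *: v] is affine in [t]; being nonnegative for every
    [t], it has zero slope, so [M *m v] is orthogonal to every [u]. *)
Lemma psd_kernel k (M : 'M[R]_k) v : psd M -> bform M v v = 0 -> M *m v = 0.
Proof.
move=> [sM pM] v0.
suff key u : bform M u v = 0.
  apply/matrixP => i j; rewrite ord1.
  have := key (delta_mx i 0).
  by rewrite /bform trmx_delta -mulmxA -rowE !mxE.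
have uv t : 0 <= bform M u u + t * (2 * bform M u v).
  have := pM (u + t *: v); rewrite -/(bform M _ _).
  rewrite !(bformDr, bformDl, bformZr, bformZl) v0 (bformC v u sM).
  lra.
apply/eqP; apply: contraT => b0.
(* At this [t] the affine function equals -1. *)
have := uv (- (bform M u u + 1) / (2 * bform M u v)).
rewrite divfK; last by rewrite mulf_neq0 // pnatr_eq0.
lra.
Qed.

Lemma unitmx_kernel k (M : 'M[R]_k) :
  (forall v : 'cV[R]_k, M *m v = 0 -> v = 0) -> M \in unitmx.
Proof.
move=> kerM; rewrite -unitmx_tr -row_free_unit; apply: inj_row_free => v vM.
apply: trmx_inj; rewrite trmx0; apply: kerM.
by apply: trmx_inj; rewrite trmx_mul trmxK vM trmx0.
Qed.

Lemma pd_unitmx k (M : 'M[R]_k) : pd M -> M \in unitmx.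
Proof.
move=> [_ pM]; apply: unitmx_kernel => v Mv; apply/eqP; apply: contraT => /pM.
by rewrite -mulmxA Mv mulmx0 mxE ltxx.
Qed.

Lemma pdD_psd k (M N : 'M[R]_k) : pd M -> psd N -> pd (M + N).
Proof.
move=> [sM pM] [sN pN]; split=> [|v v0]; first by rewrite trmxD sM sN.
by rewrite mulmxDr mulmxDl addmxE ltr_wpDr ?pM.
Qed.

Lemma invmx_sym k (M : 'M[R]_k) : M^T = M -> (invmx M)^T = invmx M.
Proof. by move=> sM; rewrite trmx_inv sM. Qed.

Lemma pd_psd k (M : 'M[R]_k) : pd M -> psd M.
Proof.
move=> [sM pM]; split=> // v; have [->|/pM/ltW//] := eqVneq v 0.
by rewrite mulmx0 mxE.
Qed.

Lemma psd_invmx k (M : 'M[R]_k) : pd M -> psd (invmx M).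
Proof.
move=> pM; have := psd_congr (invmx M) (pd_psd pM).
by rewrite invmx_sym ?pM.1 // mulVmx ?mul1mx // pd_unitmx.
Qed.

(** With [D = invmx M - invmx N], one has the identity [D = D M D + N^-1 (N - M) N^-1], a sum of two
    congruences of semidefinite matrices. *)
Lemma invmx_antitone k (M N : 'M[R]_k) :
  pd M -> loewner_le M N -> loewner_le (invmx N) (invmx M).
Proof.
rewrite /loewner_le => pM MN.
have pN : pd N by have := pdD_psd pM MN; rewrite addrC subrK.
have [uM uN] := (pd_unitmx pM, pd_unitmx pN).
have sM' := invmx_sym pM.1; have sN' := invmx_sym pN.1.
have -> : invmx M - invmx N =
  (invmx M - invmx N)^T *m M *m (invmx M - invmx N) +
  (invmx N)^T *m (N - M) *m invmx N.
  mx_expand; rewrite sM' sN' mulVmx // mul1mx -[invmx N *m M *m invmx M]mulmxA.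
  rewrite mulmxV // mulmx1 mulVmx // mul1mx.
  mx_ring.
by apply: psdD; apply: psd_congr => //; exact: pd_psd.
Qed.

Lemma psd_block_sum k l (r : nat) (U : 'I_r -> 'M[R]_k) (V : 'I_r -> 'M[R]_(k, l))
    (W : 'I_r -> 'M[R]_l) :
  (forall i, psd (block_mx (U i) (V i) (V i)^T (W i))) ->
  psd (block_mx (\sum_i U i) (\sum_i V i) (\sum_i V i)^T (\sum_i W i)).
Proof.
move=> pU; have -> : block_mx (\sum_i U i) (\sum_i V i) (\sum_i V i)^T (\sum_i W i) =
  \sum_i block_mx (U i) (V i) (V i)^T (W i); last exact: psd_sum.
elim: index_enum => [|i s IH]; first by rewrite !big_nil trmx0 block_mx0.
by rewrite !big_cons -IH add_block_mx trmxD.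
Qed.

End SemidefiniteMatrices.

(** * Spectral stability and Lyapunov inequalities *)

Section SpectralStability.
Context {R : realType}.
Import ComplexField.Normc.

(** Once [e] stays below [eps / 2 * (1 - rho)], the value [eps / 2] is a fixed point of the bounding
    recurrence, and [u] exceeds it by at most a geometric term. *)
Lemma contracting_recurrence_cvg0 (rho : R) (u e : nat -> R) :
  0 <= rho < 1 -> (forall k, 0 <= u k) -> (forall k, u k.+1 <= rho * u k + e k) ->
  e @ \oo --> 0 -> u @ \oo --> 0.
Proof.
move=> /andP[rho0 rho1] u0 ue /cvgr0Pnorm_lt e_cvg; apply/cvgr0Pnorm_lt => eps eps0.
have [|N _ eN] := e_cvg (eps / 2 * (1 - rho)); first by rewrite mulr_gt0 ?subr_gt0 ?divr_gt0.
have bound j : u (j + N)%N <= rho ^+ j * u N + eps / 2.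
  elim: j => [|j IH]; first by rewrite add0n expr0 mul1r lerDl ltW ?divr_gt0.
  have := eN (j + N)%N (leq_addl _ _) => /= /ltW/(le_trans (ler_norm _)) ej.
  have := ler_wpM2l rho0 IH; have := ue (j + N)%N; rewrite addSn exprS; lra.
have : (fun j => rho ^+ j * u N) @ \oo --> 0.
  rewrite -(mul0r (u N)); apply: cvgM; last exact: cvg_cst.
  by apply: cvg_expr; rewrite ger0_norm.
move=> /cvgr0Pnorm_lt/(_ (eps / 2))[|J _ uJ]; first by rewrite divr_gt0.
exists (J + N)%N => // k /= Jk.
have Nk : (N <= k)%N by rewrite (leq_trans (leq_addl J N)).
rewrite ger0_norm //; have := bound (k - N)%N; rewrite subnK //.
have := uJ (k - N)%N; rewrite /= leq_subRL // addnC => /(_ Jk).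
move=> /(le_lt_trans (ler_norm _)); lra.
Qed.

Definition cvg0C (u : nat -> R[i]) : Prop := (fun k => normc (u k)) @ \oo --> (0 : R).

Lemma normc_ge0 (z : R[i]) : 0 <= normc z.
Proof. by case: z => x y; exact: sqrtr_ge0. Qed.

Lemma le_Re_normc (z : R[i]) : `|complex.Re z| <= normc z.
Proof.
by case: z => x y /=; rewrite -sqrtr_sqr ler_wsqrtr // lerDl sqr_ge0.
Qed.

(** Induction on the linear factors replaces the Jordan form: [(M - z) w] is killed by the remaining
    product, so its orbit tends to 0, and it is the perturbation in a recurrence of ratio [z] for
    the orbit of [w]. *)
Lemma powers_cvg0C n (M : 'M[R[i]]_n.+1) (s : seq R[i]) (w : 'cV[R[i]]_n.+1) :
  (forall z, z \in s -> normc z < 1) ->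
  horner_mx M (\prod_(z <- s) ('X - z%:P)) *m w = 0 ->
  forall i, cvg0C (fun k => (M ^+ k *m w) i 0).
Proof.
elim: s w => [|z s IH] w s1.
  rewrite big_nil rmorph1 mul1mx => -> i; rewrite /cvg0C.
  under eq_fun do rewrite mulmx0 mxE normc0.
  exact: cvg_cst.
rewrite big_cons mulrC rmorphM rmorphB /= horner_mx_X horner_mx_C -mulmxA => ker i.
have {}IH := IH _ (fun x xs => s1 x (mem_behead (s := z :: s) xs)) ker i.
apply: (contracting_recurrence_cvg0 (rho := normc z) _ _ _ IH).
- by rewrite normc_ge0 s1 ?mem_head.
- by move=> k; exact: normc_ge0.
move=> k; rewrite -normcM.
suff -> : (M ^+ k.+1 *m w) i 0 =
    z * (M ^+ k *m w) i 0 + (M ^+ k *m ((M - z%:M) *m w)) i 0 by exact: le_normcD.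
rewrite exprSr -mulmxE mulmxBl mulmxBr mul_scalar_mx -scalemxAr !mulmxA !mxE.
ring.
Qed.

(* A pair [x, y] encodes the complex eigenvector [x + i y] for [a + i b]. *)
Lemma powers_cvg0 n (M : 'M[R]_n.+1) (w : 'cV[R]_n.+1) :
  (forall (a b : R) (x y : 'cV[R]_n.+1),
     M *m x = a *: x - b *: y -> M *m y = b *: x + a *: y ->
     1 <= a ^+ 2 + b ^+ 2 -> x = 0 /\ y = 0) ->
  forall i, (fun k => (M ^+ k *m w) i 0) @ \oo --> (0 : R).
Proof.
move=> eigM i; pose f := real_complex R; pose N := map_mx f M.
have [s /= charN] := closed_field_poly_normal (char_poly N).
move: charN; rewrite (monicP (char_poly_monic N)) scale1r => charN.
have s1 z : z \in s -> normc z < 1.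
  move=> zs; rewrite ltNge; apply/negP => z1.
  (* [eigenvalue] refers to row eigenvectors, so a column eigenvector of [N] is obtained from
     [N^T]. *)
  have : root (char_poly N^T) z.
    have -> : char_poly N^T = char_poly N; last by rewrite charN root_prod_XsubC.
    by rewrite /char_poly -det_tr /char_poly_mx raddfB /= tr_scalar_mx map_trmx trmxK.
  rewrite -eigenvalue_root_char => /eigenvalueP[v vN v0].
  have {}vN : N *m v^T = z *: v^T by rewrite -[N]trmxK -trmx_mul vN trmxZ.
  pose x := map_mx (@complex.Re R) v^T; pose y := map_mx (@complex.Im R) v^T.
  have Nv j : (N *m v^T) j 0 = Complex ((M *m x) j 0) ((M *m y) j 0).
    apply/eqP; rewrite eq_complex /= !mxE !raddf_sum /=.
    apply/andP; split; apply/eqP; apply: eq_bigr => l _;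
      by rewrite !mxE; case: (v 0 l) => ? ? /=; rewrite mul0r ?subr0 ?addr0.
  have zv j : (z *: v^T) j 0 = Complex ((complex.Re z *: x - complex.Im z *: y) j 0)
      ((complex.Im z *: x + complex.Re z *: y) j 0).
    rewrite !mxE; case: (z) (v 0 j) => [a b] [c d] /=.
    by apply/eqP; rewrite eq_complex /= !eqxx /= addrC.
  have [||| x0 y0] := eigM (complex.Re z) (complex.Im z) x y.
  - apply/matrixP => j l; rewrite ord1; have := Nv j; rewrite vN zv.
    by case=> ->.
  - apply/matrixP => j l; rewrite ord1; have := Nv j; rewrite vN zv.
    by case=> _ ->.
  - move: z1; case: (z) => a b /=; rewrite -{1}sqrtr1 ler_sqrt //.
    by rewrite addr_ge0 ?sqr_ge0.
  case/eqP: v0; apply/matrixP => j l; rewrite ord1 !mxE.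
  have := congr1 (fun m : 'cV_ _ => m l 0) x0; have := congr1 (fun m : 'cV_ _ => m l 0) y0.
  by rewrite !mxE; case: (v 0 l) => ? ? /= -> ->.
(* By Cayley-Hamilton the product of the linear factors kills every vector. *)
have NC : horner_mx N (\prod_(z <- s) ('X - z%:P)) *m map_mx f w = 0.
  by rewrite -charN Cayley_Hamilton mul0mx.
have := powers_cvg0C s1 NC i; rewrite /cvg0C => /cvgr0Pnorm_lt P0.
apply/cvgr0Pnorm_lt => eps /P0[K _ KP]; exists K => // k /KP /=.
rewrite ger0_norm ?normc_ge0 //; apply: le_lt_trans.
have -> : N ^+ k = map_mx f (M ^+ k) by rewrite rmorphXn.
rewrite -map_mxM [X in normc X]mxE; exact: (le_Re_normc (f _)).
Qed.

(** The spectrum lies in the open left half-plane; the pair [x], [y] encodes [x + i y], which keeps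
    the matrices real. *)
Definition spec_stable n (M : 'M[R]_n) : Prop :=
  forall (a b : R) (x y : 'cV[R]_n),
    M *m x = a *: x - b *: y -> M *m y = b *: x + a *: y -> 0 <= a -> x = 0 /\ y = 0.

(** This excludes eigenvalues of modulus at least 1 for the Cayley transform, written without the
    inverse of [1 - M]. The real part of [(z - 1) / (z + 1)] has the sign of [|z|^2 - 1]. *)
Lemma cayley_spectrum n (M : 'M[R]_n) (a b : R) (x y : 'cV[R]_n) :
  spec_stable M ->
  (1%:M + M) *m x = (1%:M - M) *m (a *: x - b *: y) ->
  (1%:M + M) *m y = (1%:M - M) *m (b *: x + a *: y) ->
  1 <= a ^+ 2 + b ^+ 2 -> x = 0 /\ y = 0.
Proof.
move=> stM Ex Ey ab1.
have {}Ex i : x i 0 + (M *m x) i 0 =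
    a * (x i 0 - (M *m x) i 0) - b * (y i 0 - (M *m y) i 0).
  have := congr1 (fun m : 'cV_n => m i 0) Ex.
  rewrite /= ?(mulmxDl, mulmxDr, mulmxN, mulNmx, mul1mx, =^~ scalemxAr).
  rewrite !(addmxE, oppmxE, scalemxE) => ->; ring.
have {}Ey i : y i 0 + (M *m y) i 0 =
    b * (x i 0 - (M *m x) i 0) + a * (y i 0 - (M *m y) i 0).
  have := congr1 (fun m : 'cV_n => m i 0) Ey.
  rewrite /= ?(mulmxDl, mulmxDr, mulmxN, mulNmx, mul1mx, =^~ scalemxAr).
  rewrite !(addmxE, oppmxE, scalemxE) => ->; ring.
pose d := (1 + a) ^+ 2 + b ^+ 2.
have d_ge0 : 0 <= d by rewrite addr_ge0 ?sqr_ge0.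
(* Here [d = |1 + z|^2]; it vanishes only for [z = -1], and then the equations give [x = y = 0]
   directly. *)
have [d0|d0] := eqVneq d 0.
  move/eqP: d0; rewrite paddr_eq0 ?sqr_ge0 // !sqrf_eq0 => /andP[/eqP a1 /eqP b0].
  have {}a1 : a = -1 by lra.
  split; apply/matrixP => i j; rewrite ord1 mxE.
    by have := Ex i; rewrite a1 b0; lra.
  by have := Ey i; rewrite a1 b0; lra.
(* With [z = a + i b], the eigenvalue [z] of the Cayley transform comes from the
   eigenvalue [(z - 1) / (z + 1)] of [M], with eigenvector [(1 + z) (x + i y)]. *)
have [|||p0 q0] := stM ((a ^+ 2 + b ^+ 2 - 1) / d) (2 * b / d)
    ((1 + a) *: x - b *: y) ((1 + a) *: y + b *: x).
- apply/matrixP => i j; rewrite ord1.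
  rewrite ?(mulmxDl, mulmxDr, mulmxN, mulNmx, mul1mx, =^~ scalemxAr).
  rewrite !(addmxE, oppmxE, scalemxE).
  transitivity ((a - 1) * x i 0 - b * y i 0); first by have := Ex i; lra.
  rewrite /d; field; exact: d0.
- apply/matrixP => i j; rewrite ord1.
  rewrite ?(mulmxDl, mulmxDr, mulmxN, mulNmx, mul1mx, =^~ scalemxAr).
  rewrite !(addmxE, oppmxE, scalemxE).
  transitivity ((a - 1) * y i 0 + b * x i 0); first by have := Ey i; lra.
  rewrite /d; field; exact: d0.
- by rewrite divr_ge0 // subr_ge0.
have {}p0 i : (1 + a) * x i 0 - b * y i 0 = 0.
  by have := congr1 (fun m : 'cV_n => m i 0) p0; rewrite !mxE.
have {}q0 i : (1 + a) * y i 0 + b * x i 0 = 0.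
  by have := congr1 (fun m : 'cV_n => m i 0) q0; rewrite !mxE.
(* Multiplying [(1 + z) (x + i y) = 0] by the conjugate of [1 + z] gives [d (x + i y) = 0]. *)
split; apply/matrixP => i j; rewrite ord1 mxE; apply: (mulfI d0); rewrite mulr0 /d.
  transitivity ((1 + a) * ((1 + a) * x i 0 - b * y i 0) +
                b * ((1 + a) * y i 0 + b * x i 0)); first by ring.
  by rewrite p0 q0 !mulr0 addr0.
transitivity ((1 + a) * ((1 + a) * y i 0 + b * x i 0) -
              b * ((1 + a) * x i 0 - b * y i 0)); first by ring.
by rewrite p0 q0 !mulr0 subr0.
Qed.

Lemma cvg_bigsum (I : finType) (F : I -> nat -> R) (l : I -> R) :
  (forall i, F i @ \oo --> l i) -> (fun k => \sum_i F i k) @ \oo --> \sum_i l i.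
Proof.
move=> Fl; elim: (index_enum I) => [|i s IH].
  by rewrite big_nil; under eq_fun do rewrite big_nil; exact: cvg_cst.
rewrite (_ : (fun k => _) = F i \+ (fun k => \sum_(j <- s) F j k)).
  by rewrite big_cons; apply: cvgD.
by apply/funext => k; rewrite big_cons.
Qed.

Lemma bform_cvg0 n (Z : 'M[R]_n) (u : nat -> 'cV[R]_n) :
  (forall i, (fun k => u k i 0) @ \oo --> (0 : R)) ->
  (fun k => bform Z (u k) (u k)) @ \oo --> (0 : R).
Proof.
move=> u0.
have -> : (fun k => bform Z (u k) (u k)) =
    (fun k => \sum_j (\sum_i u k i 0 * Z i j) * u k j 0).
  apply/funext => k; rewrite /bform mxE; apply: eq_bigr => j _; rewrite mxE.
  by congr (_ * _); apply: eq_bigr => i _; rewrite mxE.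
have z : \sum_(j < n) (0 : R) = 0 by rewrite big1.
rewrite -[X in _ --> X]z; apply: cvg_bigsum => j.
rewrite -[X in _ --> X](mulr0 0); apply: cvgM => //.
rewrite -[X in _ --> X]z; apply: cvg_bigsum => i.
by rewrite -[X in _ --> X](mul0r (Z i j)); apply: cvgM => //; exact: cvg_cst.
Qed.

(* The Cayley transform [P = (1 + M) (1 - M)^-1] turns the Lyapunov inequality into
   [P^T Z P <= Z]; iterating and letting [P^k v] tend to 0 gives [0 <= v^T Z v]. *)
Lemma lyapunov_psd n (M Z : 'M[R]_n) :
  spec_stable M -> Z^T = Z -> psd (- (M^T *m Z + Z *m M)) -> psd Z.
Proof.
(* The powers of [P] use the ring structure of square matrices of nonzero size. *)
case: n M Z => [|n] M Z stM sZ pN.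
  by split=> // v; rewrite [v]flatmx0 mulmx0 mxE.
have uM : 1%:M - M \in unitmx.
  apply: unitmx_kernel => x; rewrite mulmxBl mul1mx => /eqP.
  rewrite subr_eq0 eq_sym => /eqP Mx.
  (* A kernel vector of [1 - M] would be an eigenvector of [M] for the eigenvalue 1. *)
  have [] // := stM 1 0 x 0.
    by rewrite scale1r scaler0 subr0.
  by rewrite mulmx0 scale0r scaler0 addr0.
pose W := invmx (1%:M - M); pose P : 'M[R]_n.+1 := (1%:M + M) *m W.
have MW : (1%:M - M) *m W = 1%:M by rewrite mulmxV.
have stein : psd (Z - P^T *m Z *m P).
  have -> : Z - P^T *m Z *m P = W^T *m (2 *: - (M^T *m Z + Z *m M)) *m W.
    have {1}-> : Z = W^T *m ((1%:M - M)^T *m Z *m (1%:M - M)) *m W.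
      by rewrite !mulmxA -trmx_mul MW trmx1 mul1mx -mulmxA MW mulmx1.
    rewrite /P trmx_mul -!mulmxA -mulmxBr; congr (_ *m _).
    rewrite !mulmxA -mulmxBl; congr (_ *m _).
    mx_expand; mx_ring.
  by apply: psd_congr; apply: psdZ.
have P0 (w : 'cV[R]_n.+1) i : (fun k => (P ^+ k *m w) i 0) @ \oo --> (0 : R).
  apply: powers_cvg0 => a b x y Px Py ab1.
  have [||//|x0 y0] := @cayley_spectrum _ M a b (W *m x) (W *m y) stM.
  - by rewrite mulmxA Px !scalemxAr -mulmxBr mulmxA MW mul1mx.
  - by rewrite mulmxA Py !scalemxAr -mulmxDr mulmxA MW mul1mx.
  - by rewrite -[x]mul1mx -[y]mul1mx -MW -!mulmxA x0 y0 !mulmx0.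
split=> // v; rewrite -/(bform _ _ _).
have decr k : bform Z (P ^+ k *m v) (P ^+ k *m v) <= bform Z v v.
  elim: k => [|k]; first by rewrite expr0 mul1mx.
  apply: le_trans; have := stein.2 (P ^+ k *m v); rewrite -/(bform _ _ _).
  by rewrite bform_mxD bform_mxN bform_mulr bform_mull trmxK exprS -mulmxE -mulmxA subr_ge0.
apply: (ler_cvg_to (bform_cvg0 Z (P0 v)) (cvg_cst (bform Z v v))).
by apply: nearW.
Qed.

(** * From exponential decay of solutions to the spectrum *)

Lemma mxnorm_ge0 a b (M : 'M[R]_(a, b)) : 0 <= mxnorm M.
Proof. by apply: sumr_ge0 => i _; apply: sumr_ge0 => j _. Qed.

Lemma mxnorm_eq0 a b (M : 'M[R]_(a, b)) : mxnorm M = 0 -> M = 0.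
Proof.
move=> /eqP; rewrite psumr_eq0; last by move=> i _; apply: sumr_ge0.
move=> /allP M0; apply/matrixP => i j; rewrite mxE.
have := M0 i (mem_index_enum i); rewrite psumr_eq0 // => /allP/(_ j (mem_index_enum j)).
by rewrite /= normr_eq0 => /eqP.
Qed.

Lemma mxnormD a b (M N : 'M[R]_(a, b)) : mxnorm (M + N) <= mxnorm M + mxnorm N.
Proof.
rewrite -big_split /=; apply: ler_sum => i _; rewrite -big_split /=.
by apply: ler_sum => j _; rewrite mxE ler_normD.
Qed.

Lemma mxnormZ a b c (M : 'M[R]_(a, b)) : mxnorm (c *: M) = `|c| * mxnorm M.
Proof.
rewrite mulr_sumr; apply: eq_bigr => i _; rewrite mulr_sumr.
by apply: eq_bigr => j _; rewrite mxE normrM.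
Qed.

(** The curve is the real part of [exp((a + i b) t) (x + i y)]. *)
Lemma eigen_ode_solution n (M : 'M[R]_n) (a b : R) (x y : 'cV[R]_n) :
  M *m x = a *: x - b *: y -> M *m y = b *: x + a *: y ->
  ode_solution (mulmx M)
    (fun t => (expR (a * t) * cos (b * t)) *: x - (expR (a * t) * sin (b * t)) *: y).
Proof.
move=> Mx My t i j.
pose f s := expR (a * s) * cos (b * s) * x i j - expR (a * s) * sin (b * s) * y i j.
have -> : (fun s => ((expR (a * s) * cos (b * s)) *: x -
    (expR (a * s) * sin (b * s)) *: y) i j) = f by apply/funext => s; rewrite !mxE.
have df : is_derive t (1 : R) f
   (expR (a * t) * cos (b * t) * (a * x i j - b * y i j)
    - expR (a * t) * sin (b * t) * (b * x i j + a * y i j)).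
  rewrite /f; apply: is_derive_eq.
  rewrite /GRing.scale /=; ring.
split; first exact: ex_derive.
rewrite derive1E derive_val mulmxDr mulmxN -!scalemxAr Mx My !mxE; ring.
Qed.

(** For [a >= 0] the complex solution does not shrink. Its real and imaginary parts recover [x] and
    [y] by a rotation, so their exponential decay forces [x = y = 0]. *)
Lemma hurwitz_spec_stable n (M : 'M[R]_n) : hurwitz M -> spec_stable M.
Proof.
move=> [c [beta [c0 [beta0 expM]]]] a b x y Mx My a0.
(* Multiplying the eigenvector by [i] turns the pair [x, y] into [- y, x]; the resulting solution
   [S2] is minus the imaginary part. *)
have Mx' : M *m (- y) = a *: (- y) - b *: x.
  by rewrite mulmxN My scalerN opprD addrC.
have My' : M *m x = b *: (- y) + a *: x by rewrite Mx scalerN addrC.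
pose S1 t := (expR (a * t) * cos (b * t)) *: x - (expR (a * t) * sin (b * t)) *: y.
pose S2 t := (expR (a * t) * cos (b * t)) *: - y - (expR (a * t) * sin (b * t)) *: x.
have bound1 := expM S1 (eigen_ode_solution Mx My).
have bound2 := expM S2 (eigen_ode_solution Mx' My').
pose H := mxnorm x + mxnorm y; pose D := 2 * c * (mxnorm (S1 0) + mxnorm (S2 0)).
have [nx ny] := (mxnorm_ge0 x, mxnorm_ge0 y).
suff H0 : H <= 0 by rewrite /H in H0; split; apply: mxnorm_eq0; lra.
have D0 : 0 <= D by rewrite mulr_ge0 ?addr_ge0 ?mxnorm_ge0 // mulr_ge0 // ltW.
have rot t (g h : R) z : 0 <= t -> `|g| <= 1 -> `|h| <= 1 ->
    expR (a * t) *: z = g *: S1 t + h *: S2 t ->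
    mxnorm z <= mxnorm (S1 t) + mxnorm (S2 t).
  move=> t0 g1 h1 zE; have := mxnormD (g *: S1 t) (h *: S2 t).
  rewrite -zE !mxnormZ => zS.
  have e1 : 1 <= `|expR (a * t)|.
    by rewrite ger0_norm ?expR_ge0 // -expR0 ler_expR mulr_ge0.
  apply: le_trans (_ : `|expR (a * t)| * mxnorm z <= _).
    by rewrite ler_peMl ?mxnorm_ge0.
  by apply: (le_trans zS); apply: lerD; apply: ler_piMl; rewrite ?mxnorm_ge0.
have decay t : 0 <= t -> H * expR (beta * t) <= D.
  move=> t0; have cs := cos2Dsin2 (b * t).
  have x1 : mxnorm x <= mxnorm (S1 t) + mxnorm (S2 t).
    apply: (rot t (cos (b * t)) (- sin (b * t))); rewrite ?normrN ?cos_max ?sin_max //.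
    apply/matrixP => i j; rewrite !mxE.
    rewrite -[LHS]mulr1 -cs; ring.
  have y1 : mxnorm y <= mxnorm (S1 t) + mxnorm (S2 t).
    apply: (rot t (- sin (b * t)) (- cos (b * t))); rewrite ?normrN ?cos_max ?sin_max //.
    apply/matrixP => i j; rewrite !mxE.
    rewrite -[LHS]mulr1 -cs; ring.
  have eb : expR (- (beta * t)) * expR (beta * t) = 1 by rewrite -expRD addNr expR0.
  have e0 := expR_gt0 (beta * t).
  rewrite -ler_pdivlMr // -expRN; have := bound1 t t0; have := bound2 t t0.
  rewrite /H /D; lra.
rewrite leNgt; apply/negP => H0.
(* At this time [expR (beta * t)] is at least [1 + D / H], so [decay] would give [H + D <= D]. *)
have := decay (D / (beta * H)) (divr_ge0 D0 (mulr_ge0 (ltW beta0) (ltW H0))).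
have := expR_ge1Dx (beta * (D / (beta * H))).
have -> : beta * (D / (beta * H)) = D / H by field; rewrite !gt_eqF.
move=> /(ler_wpM2l (ltW H0)); rewrite mulrDr mulr1 mulrC divfK ?gt_eqF //.
lra.
Qed.

End SpectralStability.

(** * Entrywise limits and monotone convergence of matrices *)

Section MatrixLimits.
Context {R : realType}.

Definition mxcvg a b (u : nat -> 'M[R]_(a, b)) (M : 'M[R]_(a, b)) : Prop :=
  forall i j, (fun k => u k i j) @ \oo --> M i j.

Lemma mxcvg_cst a b (M : 'M[R]_(a, b)) : mxcvg (fun=> M) M.
Proof. by move=> i j; exact: cvg_cst. Qed.

Lemma mxcvgD a b (u v : nat -> 'M[R]_(a, b)) M N :
  mxcvg u M -> mxcvg v N -> mxcvg (fun k => u k + v k) (M + N).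
Proof.
move=> uM vN i j; rewrite mxE; under eq_fun do rewrite mxE.
by apply: cvgD; [exact: uM | exact: vN].
Qed.

Lemma mxcvgN a b (u : nat -> 'M[R]_(a, b)) M :
  mxcvg u M -> mxcvg (fun k => - u k) (- M).
Proof.
move=> uM i j; rewrite mxE; under eq_fun do rewrite mxE.
by apply: cvgN; exact: uM.
Qed.

Lemma mxcvg_tr a b (u : nat -> 'M[R]_(a, b)) M :
  mxcvg u M -> mxcvg (fun k => (u k)^T) M^T.
Proof.
by move=> uM i j; rewrite mxE; under eq_fun do rewrite mxE; exact: uM.
Qed.

Lemma mxcvgM a b c (u : nat -> 'M[R]_(a, b)) (v : nat -> 'M[R]_(b, c)) M N :
  mxcvg u M -> mxcvg v N -> mxcvg (fun k => u k *m v k) (M *m N).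
Proof.
move=> uM vN i j; rewrite mxE; under eq_fun do rewrite mxE.
by apply: cvg_bigsum => l; apply: cvgM; [exact: uM | exact: vN].
Qed.

Lemma mxcvg_sum a b (I : finType) (F : nat -> I -> 'M[R]_(a, b)) M :
  (forall i, mxcvg (F^~ i) (M i)) -> mxcvg (fun k => \sum_i F k i) (\sum_i M i).
Proof.
move=> FM i j; rewrite summxE; under eq_fun do rewrite summxE.
by apply: cvg_bigsum => l; exact: FM.
Qed.

Lemma mxcvg_shift a b (u : nat -> 'M[R]_(a, b)) M :
  mxcvg u M -> mxcvg (fun k => u k.+1) M.
Proof. by move=> uM i j; rewrite (cvg_shiftS (fun k => u k i j)); exact: uM. Qed.

Lemma mxcvg_unique a b (u : nat -> 'M[R]_(a, b)) M N :
  mxcvg u M -> mxcvg u N -> M = N.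
Proof.
by move=> uM uN; apply/matrixP => i j; apply: cvg_unique (uM i j) (uN i j).
Qed.

Lemma mxcvg_psd k (u : nat -> 'M[R]_k) M :
  mxcvg u M -> (forall l, psd (u l)) -> psd M.
Proof.
move=> uM pu; split.
  apply: mxcvg_unique (uM); have := mxcvg_tr uM.
  by rewrite (_ : (fun l => (u l)^T) = u) //; apply/funext => l; rewrite (pu l).1.
move=> v.
have cvgq := mxcvgM (mxcvgM (@mxcvg_cst _ _ v^T) uM) (@mxcvg_cst _ _ v).
apply: (ler_cvg_to (cvg_cst (0 : R)) (cvgq 0 0)).
by apply: nearW => l; exact: (pu l).2.
Qed.

Lemma loewner_bform k (M N : 'M[R]_k) v : loewner_le M N -> bform M v v <= bform N v v.
Proof.
by move=> [_ /(_ v)]; rewrite -/(bform _ _ _) bform_mxD bform_mxN subr_ge0.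
Qed.

(** Each quadratic form is monotone and bounded, hence convergent; polarization recovers the entries
    from the forms. *)
Lemma loewner_mxcvg k (u : nat -> 'M[R]_k) (Y : 'M[R]_k) :
  (forall l, (u l)^T = u l) -> (forall l, loewner_le (u l) (u l.+1)) ->
  (forall l, loewner_le (u l) Y) -> exists M, mxcvg u M.
Proof.
move=> su incr ub.
have qcvg v : cvgn (fun l => bform (u l) v v).
  apply: nondecreasing_is_cvgn.
    by apply/nondecreasing_seqP => l; exact: loewner_bform.
  by exists (bform Y v v) => _ [l _ <-]; exact: loewner_bform.
pose q v := limn (fun l => bform (u l) v v).
pose e i : 'cV[R]_k := delta_mx i 0.
exists (\matrix_(i, j) ((q (e i + e j) - q (e i) - q (e j)) / 2)) => i j.
have -> : (fun l => u l i j) = (fun l => (bform (u l) (e i + e j) (e i + e j)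
     - bform (u l) (e i) (e i) - bform (u l) (e j) (e j)) / 2).
  apply/funext => l; rewrite bformDl !bformDr (bformC (e j) (e i) (su l)) /e !bform_delta.
  by field.
rewrite mxE; apply: cvgM; last exact: cvg_cst.
by apply: cvgB; [apply: cvgB|]; exact: qcvg.
Qed.

(** The inverses decrease and are bounded below by 0, so they converge; passing to the limit in
    [u l *m invmx (u l) = 1] identifies the limit and shows that [M] is invertible. *)
Lemma mxcvg_invmx k (u : nat -> 'M[R]_k) M :
  (forall l, pd (u l)) -> (forall l, loewner_le (u l) (u l.+1)) ->
  mxcvg u M -> mxcvg (fun l => invmx (u l)) (invmx M).
Proof.
move=> pu incr uM.
have pinv l := psd_invmx (pu l).
have [|||J cJ] := @loewner_mxcvg k (fun l => - invmx (u l)) 0.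
- by move=> l; rewrite trmxN (pinv l).1.
- move=> l; have := invmx_antitone (pu l) (incr l).
  by rewrite /loewner_le opprK addrC.
- by move=> l; rewrite /loewner_le sub0r opprK.
have {}cJ : mxcvg (fun l => invmx (u l)) (- J).
  by have := mxcvgN cJ; under eq_fun do rewrite opprK.
suff MJ : M *m - J = 1%:M.
  have [uM' _] := mulmx1_unit MJ.
  by rewrite -[invmx M]mulmx1 -MJ mulKmx.
apply: mxcvg_unique (mxcvgM uM cJ) _.
rewrite (_ : (fun l => _) = fun=> 1%:M); first exact: mxcvg_cst.
by apply/funext => l; rewrite mulmxV // pd_unitmx.
Qed.

End MatrixLimits.

(** * The Riccati map and a single Newton step *)

Section NewtonStep.
Context {R : realType} {n m r : nat}.
Variables (A : 'M[R]_n) (B : 'M[R]_(n, m)) (Q : 'M[R]_n) (L : 'M[R]_(n, m))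
          (Rm : 'M[R]_m) (A0 : 'I_r -> 'M[R]_n) (B0 : 'I_r -> 'M[R]_(n, m)).

Local Notation Rc := (Rc Rm B0).
Local Notation Ahat := (Ahat A B L Rm A0 B0).
Local Notation Ricc := (Ricc A B Q L Rm A0 B0).
Local Notation Omega := (Omega A B Q L Rm A0 B0).
Local Notation FW := (FW A B Q L Rm A0 B0).
Local Notation Gc := (Gc B Rm B0).

(** Each summand is the congruence of [X] by the row block [[A0 i, B0 i]]. *)
Lemma psd_Pi X : psd X -> psd (Pi A0 B0 X).
Proof.
move=> pX; apply: psd_block_sum => i.
have := psd_congr (row_mx (A0 i) (B0 i)) pX.
rewrite tr_row_mx mul_col_mx mul_col_row !trmx_mul trmxK pX.1.
by rewrite !mulmxA.
Qed.

Lemma psd_Pi22 X : psd X -> psd (Pi22 B0 X).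
Proof. by move=> pX; apply: psd_sum => i; exact: psd_congr. Qed.

Lemma Rc_loewner X Y : loewner_le X Y -> loewner_le (Rc X) (Rc Y).
Proof.
rewrite /loewner_le => /psd_Pi22; congr (psd _).
rewrite /Defs.Rc /Pi22 opprD addrACA subrr add0r -sumrB.
by apply: eq_bigr => i _; rewrite mulmxBr mulmxBl.
Qed.

Lemma pd_Rc X : pd Rm -> psd X -> pd (Rc X).
Proof. by move=> pR /psd_Pi22; exact: pdD_psd. Qed.

Lemma Omega_quadratic W Y : (XI Y)^T *m Omega W *m XI Y =
  Y^T *m Ac A B L Rm A0 B0 W + (Ac A B L Rm A0 B0 W)^T *m Y
  + Hc Q L Rm A0 B0 W - Y^T *m Gc W *m Y.
Proof.
rewrite /XI /Defs.Omega tr_col_mx mul_row_block mul_row_col.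
move: (Ac _ _ _ _ _ _ _) (Gc _) (Hc _ _ _ _ _ _) => ? ? ?.
mx_expand; mx_ring.
Qed.

Lemma SkE W : Sk B L A0 B0 W = W *m B + Lc L A0 B0 W.
Proof. by rewrite /Sk /Lc addrA. Qed.

Lemma AhatE W :
  Ahat W = A - B *m invmx (Rc W) *m (W *m B + Lc L A0 B0 W)^T.
Proof. by rewrite -SkE. Qed.

(** With the coefficients frozen at [W] the map is quadratic in [Y], so its Taylor expansion at [W]
    stops at order two; the derivative is the Lyapunov operator of [Ahat W]. *)
Lemma Omega_quadratic_expansion W Y : pd (Rc W) -> symm W -> symm Y ->
  (XI Y)^T *m Omega W *m XI Y =
  Ricc W + (Ahat W)^T *m (Y - W) + (Y - W) *m Ahat W - (Y - W) *m Gc W *m (Y - W).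
Proof.
move=> pR sW sY; rewrite /Defs.Ricc !Omega_quadratic.
rewrite AhatE /Ac /Defs.Gc.
move: (Lc _ _ _ _) (Hc _ _ _ _ _ _) => ? ?.
mx_expand; rewrite (invmx_sym pR.1) sW sY.
mx_ring.
Qed.

Lemma Ricc_expansion W Y : pd (Rc W) -> symm W -> symm Y ->
  Ricc Y = Ricc W + (Ahat W)^T *m (Y - W) + (Y - W) *m Ahat W
    - (Y - W) *m Gc W *m (Y - W) + FW W Y.
Proof.
move=> pR sW sY; rewrite -Omega_quadratic_expansion // /Defs.FW mulmxBr mulmxBl.
by rewrite addrC subrK.
Qed.

(** The terms with [Pihat] and [Mk] merge into one congruence by [Pk], in which [J Rc J = J] for
    [J = invmx (Rc W)] is the only relation needed. *)
Lemma newton_residual W V : pd (Rc W) -> symm W ->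
  (Ahat W)^T *m V + V *m Ahat W + Pihat B L Rm A0 B0 W W + Mk B Q L Rm A0 B0 W =
  Ricc W + (Ahat W)^T *m (V - W) + (V - W) *m Ahat W.
Proof.
move=> pR sW; rewrite -addrA AhatE /Pihat /Mk -mulmxDl -mulmxDr.
rewrite /Defs.Ricc Omega_quadratic.
have -> : Pi A0 B0 W + block_mx Q L L^T Rm =
    block_mx (Qc Q A0 W) (Lc L A0 B0 W) (Lc L A0 B0 W)^T (Rc W).
  by rewrite add_block_mx -trmxD /Qc /Lc /Defs.Rc; congr block_mx; rewrite addrC.
rewrite /Pk tr_col_mx mul_row_block mul_row_col.
rewrite SkE /Ac /Hc /Defs.Gc -[Rk _ _ _]/(Rc W).
set J := invmx (Rc W).
have sJ : J^T = J by exact: invmx_sym pR.1.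
have JRJ a b (E : 'M[R]_(a, m)) (F : 'M[R]_(m, b)) :
    E *m J *m Rc W *m J *m F = E *m J *m F.
  by rewrite -!mulmxA (mulmxA J) mulVmx ?pd_unitmx // mul1mx.
clearbody J; move: (Lc _ _ _ _) (Qc _ _ _) (Rc W) JRJ => L' Q' R' JRJ.
mx_expand; rewrite sJ sW !JRJ.
mx_ring.
Qed.

Lemma Ricc_tangent_lower W Y :
  pd Rm -> psd W -> symm Y ->
  psd (FW W Y - (Y - W) *m B *m invmx Rm *m B^T *m (Y - W)) ->
  psd (Ricc Y - (Ricc W + (Ahat W)^T *m (Y - W) + (Y - W) *m Ahat W)).
Proof.
move=> pR pW sY pF; have pRW := pd_Rc pR pW.
have : loewner_le Rm (Rc W) by rewrite /loewner_le addrC addKr; exact: psd_Pi22.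
(* The congruence by [B^T (Y - W)] yields the gap between [B Rm^-1 B^T] and [Gc W], which is added
   to the hypothesis on [FW]. *)
move=> /(invmx_antitone pR)/(psd_congr (B^T *m (Y - W)))/(psdD pF).
rewrite (Ricc_expansion pRW pW.1 sY); congr (psd _).
rewrite trmx_mul trmxK trmxD trmxN sY pW.1 /Defs.Gc.
move: (FW W Y) (Ricc W) (Ahat W) (Y - W) => F X M E.
mx_expand; mx_ring.
Qed.

Definition schur_compl : 'M[R]_n := Q - L *m invmx Rm *m L^T.

(* The kernel condition forces the feedback to vanish on undamped directions,
   so there the closed loop agrees with [A]. *)
Lemma Mk_kernel W z : pd Rm -> psd (block_mx Q L L^T Rm) ->
  (forall v : 'cV[R]_n, schur_compl *m v = 0 -> L^T *m v = 0) ->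
  bform (Mk B Q L Rm A0 B0 W) z z = 0 -> schur_compl *m z = 0 /\ Ahat W *m z = A *m z.
Proof.
move=> pR pQ kerS; rewrite /Mk bform_mulr bform_mull trmxK => /(psd_kernel pQ).
set K := invmx (Rc W) *m (Sk B L A0 B0 W)^T *m z.
have -> : Pk B L Rm A0 B0 W *m z = col_mx z (- K).
  by rewrite mul_col_mx mul1mx mulNmx.
(* The two block rows read [Q z = L K] and [L^T z = Rm K]; eliminating [K] leaves the Schur
   complement. *)
rewrite mul_block_col -[0]col_mx0 => /eq_col_mx; rewrite !mulmxN => -[/eqP Qz /eqP Lz].
rewrite !subr_eq0 in Qz Lz; have uR := pd_unitmx pR.
have KL : K = invmx Rm *m (L^T *m z) by rewrite (eqP Lz) mulKmx.
have Sz : schur_compl *m z = 0.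
  by rewrite mulmxBl (eqP Qz) KL !mulmxA subrr.
split=> //; rewrite /Defs.Ahat mulmxBl -[B *m _ *m _]mulmxA -[B *m _ *m z]mulmxA -/K.
by rewrite KL kerS // !mulmx0 subr0.
Qed.

(** Evaluate the Newton equation at [x] and at [y] and add: the cross terms in [b] cancel, and for
    [a >= 0] the remaining terms are nonnegative with sum 0, so both [Mk] forms vanish. *)
Lemma spec_stable_Ahat W V : pd Rm -> psd (block_mx Q L L^T Rm) ->
  (forall v : 'cV[R]_n, schur_compl *m v = 0 -> L^T *m v = 0) ->
  detectable schur_compl A -> psd W -> psd V -> newton_step A B Q L Rm A0 B0 W V ->
  spec_stable (Ahat W).
Proof.
move=> pR pQ kerS [K /hurwitz_spec_stable stK] pW pV step a b x y Mx My a0.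
have pPi := psd_congr (Pk B L Rm A0 B0 W) (psd_Pi pW).
have pM := psd_congr (Pk B L Rm A0 B0 W) pQ.
have lyap z : 2 * bform V z (Ahat W *m z)
    + bform (Pihat B L Rm A0 B0 W W) z z + bform (Mk B Q L Rm A0 B0 W) z z = 0.
  transitivity (bform (0 : 'M[R]_n) z z); last by rewrite /bform mulmx0 mul0mx mxE.
  rewrite -step !bform_mxD (bform_mull V (Ahat W)^T) trmxK (bform_mulr V (Ahat W)).
  rewrite (bformC (Ahat W *m z) z pV.1); ring.
have := lyap y; have := lyap x.
rewrite Mx My -scaleNr !bformDr !bformZr (bformC y x pV.1).
have := pPi.2 x; have := pPi.2 y; have := pM.2 x; have := pM.2 y.
rewrite -!/(bform _ _ _) -/(Mk _ _ _ _ _ _ _) -/(Pihat _ _ _ _ _ _ _).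
have := mulr_ge0 a0 (pV.2 x); have := mulr_ge0 a0 (pV.2 y); rewrite -!/(bform _ _ _).
move=> ? ? ? ? ? ? ? ?.
have [|Sx Ax] := @Mk_kernel W x pR pQ kerS; first by lra.
have [|Sy Ay] := @Mk_kernel W y pR pQ kerS; first by lra.
(* On these vectors [A + K schur_compl], [A] and [Ahat W] agree, so the pair is an eigenpair of a
   Hurwitz matrix. *)
by apply: (stK a b); rewrite // mulmxDl -mulmxA ?Sx ?Sy mulmx0 addr0 -?Ax -?Ay.
Qed.

Lemma newton_step_monotone W V Xs :
  pd Rm -> psd W -> psd V -> psd Xs -> spec_stable (Ahat W) ->
  newton_step A B Q L Rm A0 B0 W V -> Ricc Xs = 0 -> psd (Ricc W) ->
  psd (FW W Xs - (Xs - W) *m B *m invmx Rm *m B^T *m (Xs - W)) ->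
  loewner_le W V /\ loewner_le V Xs.
Proof.
move=> pR pW pV pX stA + RXs pRW pF; have pRcW := pd_Rc pR pW.
rewrite /newton_step (newton_residual V pRcW pW.1) => step.
have := Ricc_tangent_lower pR pW pX.1 pF; rewrite RXs => tangent.
split; apply: (lyapunov_psd stA).
- by rewrite trmxD trmxN pW.1 pV.1.
- move: pRW; congr (psd _); apply/eqP.
  by rewrite -addr_eq0 addrA step.
- by rewrite trmxD trmxN pX.1 pV.1.
(* Writing 0 as the left-hand side of [step] cancels [Ricc W] and leaves the Lyapunov operator at
   [Xs - V]. *)
move: tangent; rewrite -[X in psd (X - _)]step; congr (psd _).
move: (Ricc W) (Ahat W) => ? ?; mx_expand; mx_ring.
Qed.

(** Once the inverses are known to converge, only sums, products and transposes remain. *)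
Lemma mxcvg_Ricc (X : nat -> 'M[R]_n) M :
  mxcvg X M -> mxcvg (fun k => invmx (Rc (X k))) (invmx (Rc M)) ->
  mxcvg (fun k => Ahat (X k)) (Ahat M) /\ mxcvg (fun k => Ricc (X k)) (Ricc M).
Proof.
move=> XM JM.
have cP a b (E : 'I_r -> 'M[R]_(n, a)) (F : 'I_r -> 'M[R]_(n, b)) :
    mxcvg (fun k => \sum_i (E i)^T *m X k *m F i) (\sum_i (E i)^T *m M *m F i).
  by apply: mxcvg_sum => i; apply: mxcvgM; [apply: mxcvgM|]; rewrite //; exact: mxcvg_cst.
have cL : mxcvg (fun k => Lc L A0 B0 (X k)) (Lc L A0 B0 M).
  by apply: mxcvgD; [exact: mxcvg_cst | exact: cP].
have cS : mxcvg (fun k => Sk B L A0 B0 (X k)) (Sk B L A0 B0 M).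
  apply: mxcvgD; last exact: cP.
  by apply: mxcvgD; [apply: mxcvgM|]; rewrite //; exact: mxcvg_cst.
have cBJ : mxcvg (fun k => B *m invmx (Rc (X k))) (B *m invmx (Rc M)).
  by apply: mxcvgM => //; exact: mxcvg_cst.
have cA : mxcvg (fun k => Ac A B L Rm A0 B0 (X k)) (Ac A B L Rm A0 B0 M).
  apply: mxcvgD; first exact: mxcvg_cst.
  by apply: mxcvgN; apply: mxcvgM => //; exact: mxcvg_tr.
split.
  apply: mxcvgD; first exact: mxcvg_cst.
  by apply: mxcvgN; apply: mxcvgM => //; exact: mxcvg_tr.
have RE Y : Ricc Y = _ := Omega_quadratic Y Y.
rewrite RE; under eq_fun do rewrite RE.
have cT := mxcvg_tr XM.
apply: mxcvgD; first apply: mxcvgD; first apply: mxcvgD.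
- exact: mxcvgM.
- by apply: mxcvgM => //; exact: mxcvg_tr.
- apply: mxcvgD; first by apply: mxcvgD; [exact: mxcvg_cst | exact: cP].
  by apply: mxcvgN; apply: mxcvgM; [exact: mxcvgM | exact: mxcvg_tr].
apply: mxcvgN; apply: mxcvgM => //; apply: mxcvgM => //; apply: mxcvgM => //.
exact: mxcvg_cst.
Qed.

End NewtonStep.

(** * Invariants of the iteration and passage to the limit *)

Unset Implicit Arguments.
Set Strict Implicit.
Set Printing Implicit Defensive.

Theorem theoremC5 (R : realType) (n m r p : nat)
  (A : 'M[R]_n) (B : 'M[R]_(n, m)) (Q : 'M[R]_n) (L : 'M[R]_(n, m))
  (Rm : 'M[R]_m) (A0 : 'I_r -> 'M[R]_n) (B0 : 'I_r -> 'M[R]_(n, m))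
  (C : 'M[R]_(p, n))
  (* (1) *)
  (HR : pd Rm)
  (HQLR : psd (block_mx Q L L^T Rm))
  (* (2) *)
  (H2 : exists F : 'M[R]_(m, n),
     exp_stable (fun S : 'M[R]_n =>
       (A + B *m F) *m S + S *m (A + B *m F)^T
       + \sum_(i < r) (A0 i + B0 i *m F) *m S *m (A0 i + B0 i *m F)^T))
  (* (3) *)
  (HC : C^T *m C = Q - L *m invmx Rm *m L^T)
  (H3 : exists K : 'M[R]_(n, p),
     exp_stable (fun S : 'M[R]_n =>
       (A - B *m invmx Rm *m L^T + K *m C) *m S
       + S *m (A - B *m invmx Rm *m L^T + K *m C)^T
       + \sum_(i < r) (A0 i - B0 i *m invmx Rm *m L^T) *m S
                        *m (A0 i - B0 i *m invmx Rm *m L^T)^T))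
  (* (4) *)
  (H4 : forall v : 'cV[R]_n, (Q - L *m invmx Rm *m L^T) *m v = 0 ->
          L^T *m v = 0 /\ forall i : 'I_r, A0 i *m v = 0)
  (* (5) *)
  (H5 : stabilizable A B /\ detectable (Q - L *m invmx Rm *m L^T) A)
  (* X_* : the unique symmetric psd solution of R(X) = 0 *)
  (Xs : 'M[R]_n)
  (HXs : psd Xs /\ Ricc A B Q L Rm A0 B0 Xs = 0)
  (HXs_uniq : forall X : 'M[R]_n, psd X -> Ricc A B Q L Rm A0 B0 X = 0 -> X = Xs)
  (Halpha : exists alpha : R, 0 < alpha /\
     forall Z : 'M[R]_n, psd Z ->
       loewner_le (alpha *: Z) (FcalW B L Rm A0 B0 Xs Z))
  (* the iteration *)
  (X : nat -> 'M[R]_n)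
  (HX0sym : symm (X 0%N))
  (HX0 : loewner_le 0 (X 0%N) /\ loewner_le (X 0%N) Xs)
  (HRX0 : psd (Ricc A B Q L Rm A0 B0 (X 0%N)))
  (HFW : forall W Y : 'M[R]_n, symm W -> symm Y ->
     loewner_le (X 0%N) W -> loewner_le W Y -> loewner_le Y Xs ->
     psd (FW A B Q L Rm A0 B0 W Y - (Y - W) *m B *m invmx Rm *m B^T *m (Y - W)))
  (Hseq : forall k : nat, newton_step A B Q L Rm A0 B0 (X k) (X k.+1))
  (Hpos : forall k : nat, psd (X k)) :
  (forall k : nat,
     loewner_le (X k) (X k.+1) /\ loewner_le (X k) Xs /\
     psd (Ricc A B Q L Rm A0 B0 (X k)))
  /\ (forall i j : 'I_n, (fun k => X k i j) @ \oo --> Xs i j).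
Proof.
have [pXs RXs] := HXs.
have kerL (v : 'cV[R]_n) : schur_compl Q L Rm *m v = 0 -> L^T *m v = 0.
  by move=> Sv; have [] := H4 v Sv.
have lin k : Ricc A B Q L Rm A0 B0 (X k)
    + (Ahat A B L Rm A0 B0 (X k))^T *m (X k.+1 - X k)
    + (X k.+1 - X k) *m Ahat A B L Rm A0 B0 (X k) = 0.
  rewrite -newton_residual; [exact: Hseq | exact: pd_Rc | exact: (Hpos k).1].
have step k : loewner_le (X 0%N) (X k) -> loewner_le (X k) Xs ->
    psd (Ricc A B Q L Rm A0 B0 (X k)) ->
    [/\ loewner_le (X k) (X k.+1), loewner_le (X k.+1) Xs &
       psd (Ricc A B Q L Rm A0 B0 (X k.+1))].
  move=> X0k kXs pRk.
  have stA := spec_stable_Ahat HR HQLR kerL H5.2 (Hpos k) (Hpos k.+1) (Hseq k).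
  (* [HFW] is used twice: at [Xs], to place [X k.+1] between [X k] and [Xs], and then, thanks to
     that order, at [X k.+1], to bound its residual below. *)
  have pFs := HFW (X k) Xs (Hpos k).1 pXs.1 X0k kXs (loewner_refl Xs).
  have [kk1 k1s] :=
    newton_step_monotone HR (Hpos k) (Hpos k.+1) pXs stA (Hseq k) RXs pRk pFs.
  have pF1 := HFW (X k) (X k.+1) (Hpos k).1 (Hpos k.+1).1 X0k kk1 k1s.
  split=> //; have := Ricc_tangent_lower HR (Hpos k) (Hpos k.+1).1 pF1.
  by rewrite lin subr0.
have inv k : [/\ loewner_le (X 0%N) (X k), loewner_le (X k) Xs &
    psd (Ricc A B Q L Rm A0 B0 (X k))].
  elim: k => [|k [X0k kXs pRk]]; first by split=> //; [exact: loewner_refl | exact: HX0.2].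
  have [kk1 k1s pRk1] := step k X0k kXs pRk.
  by split=> //; exact: loewner_trans X0k kk1.
have incr k : loewner_le (X k) (X k.+1) by have [a b c] := inv k; have [] := step k a b c.
split=> [k|]; first by have [_ kXs pRk] := inv k; split=> //; exact: incr.
have [M XM] : exists M, mxcvg X M.
  apply: (@loewner_mxcvg _ _ X Xs (fun k => (Hpos k).1) incr) => k.
  by have [] := inv k.
have pM := mxcvg_psd XM Hpos.
have RM : mxcvg (fun k => Rc Rm B0 (X k)) (Rc Rm B0 M).
  apply: mxcvgD; first exact: mxcvg_cst.
  apply: mxcvg_sum => i; apply: mxcvgM; last exact: mxcvg_cst.
  by apply: mxcvgM => //; exact: mxcvg_cst.
have JM := mxcvg_invmx (fun k => pd_Rc B0 HR (Hpos k)) (fun k => Rc_loewner Rm B0 (incr k)) RM.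
have [AM RicM] := mxcvg_Ricc A B Q L A0 XM JM.
have EM : mxcvg (fun k => X k.+1 - X k) (M - M).
  by apply: mxcvgD; [exact: mxcvg_shift | exact: mxcvgN].
(* In the limit of [lin] the increments vanish, so only [Ricc M = 0] remains. *)
have := mxcvgD (mxcvgD RicM (mxcvgM (mxcvg_tr AM) EM)) (mxcvgM EM AM).
rewrite subrr mulmx0 mul0mx !addr0 => cR.
suff <- : M = Xs by exact: XM.
apply: HXs_uniq => //; apply: mxcvg_unique cR _.
rewrite (_ : (fun k => _) = fun=> 0); first exact: mxcvg_cst.
by apply/funext => k; exact: lin.
Qed.
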